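(* Let $\mathbf A=(A,\le,0,1)$ be a bounded poset, $T$ a nonempty set, and $P,G:\mathcal P_+(A^T)\to(\mathcal P_+A)^T$ maps. The following are equivalent: 1. $P,G$ form a Galois connection, i.e. for all $C,D\in\mathcal P_+(A^T)$: $P(C)\le_2 D$ if and only if $C\le_1 G(D)$. 2. $P,G$ satisfy (T1) and (T2): for all $C,D\in\mathcal P_+(A^T)$, (T1) if $C\le_1 D$ then $P(C)\le_2P(D)$, and if $C\le_2D$ then $G(C)\le_1G(D)$; (T2) $C\le_1(G*P)(C)$ and $(P*G)(C)\le_2 C$.
   Context: $\mathcal P_+(X)$ = nonempty subsets of $X$. $A^T$ is ordered componentwise. For subsets $X,Y$ of $A^T$: $X\le_1Y$ iff every $x\in X$ lies below some $y\in Y$; $X\le_2Y$ iff every $y\in Y$ lies above some $x\in X$. Each $Z\in(\mathcal P_+A)^T$ is identified with the subset $\varphi(Z)=\{q\in A^T\mid q(t)\in Z(t)\ \forall t\in T\}$ of $A^T$ for comparisons. For maps $X,Y:\mathcal P_+(A^T)\to(\mathcal P_+A)^T$, $X*Y=X\circ\varphi\circ Y$. *)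

(* Defs.v *)
From mathcomp Require Import all_boot all_order.
From mathcomp Require Import boolp classical_sets.

Set Implicit Arguments.
Unset Strict Implicit.
Unset Printing Implicit Defensive.

Local Open Scope classical_set_scope.
Local Open Scope order_scope.

Definition pset (X : Type) : Type := {S : set X | S !=set0}.

Definition pset_set (X : Type) (S : pset X) : set X := proj1_sig S.
Coercion pset_set : pset >-> set.

Definition le1 (d : Order.disp_t) (Q : porderType d) (X Y : set Q) : Prop :=
  forall x, X x -> exists2 y, Y y & x <= y.

Definition le2 (d : Order.disp_t) (Q : porderType d) (X Y : set Q) : Prop :=
  forall y, Y y -> exists2 x, X x & x <= y.

(* On [T -> A], [<=] is the pointwise order declared in boolp (see [lefP]). *)
Notation "X <=_1 Y" := (le1 X Y) (at level 70, no associativity).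
Notation "X <=_2 Y" := (le2 X Y) (at level 70, no associativity).

Section Phi.
Variables (T A : Type).

Definition phi_set (Z : T -> pset A) : set (T -> A) :=
  [set q | forall t, (Z t : set A) (q t)].

Lemma phi_set_nonempty (Z : T -> pset A) : phi_set Z !=set0.
Proof. by have [q Zq] := choice (fun t => proj2_sig (Z t)); exists q. Qed.

Definition phi (Z : T -> pset A) : pset (T -> A) :=
  exist _ (phi_set Z) (phi_set_nonempty Z).

Definition star (X Y : pset (T -> A) -> T -> pset A) :
    pset (T -> A) -> T -> pset A :=
  X \o phi \o Y.

End Phi.

(* Main.v *)
Require Import Defs.
From mathcomp Require Import all_boot all_order.
From mathcomp Require Import boolp classical_sets.

(** This is the unit-counit description of an adjunction between preorders: sets under [<=_1] on the
    side of [C], under [<=_2] on the side of [D], with [phi] turning values of [P] and [G] back into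
    arguments. Only reflexivity and transitivity of the two relations matter, never antisymmetry or
    the shape of [phi]. *)

Lemma le1_refl (d : Order.disp_t) (Q : porderType d) (X : set Q) : X <=_1 X.
Proof. by move=> x Xx; exists x. Qed.

Lemma le2_refl (d : Order.disp_t) (Q : porderType d) (X : set Q) : X <=_2 X.
Proof. by move=> x Xx; exists x. Qed.

Lemma le1_trans (d : Order.disp_t) (Q : porderType d) (X Y Z : set Q) :
  X <=_1 Y -> Y <=_1 Z -> X <=_1 Z.
Proof.
move=> XY YZ x /XY [y /YZ [z Zz yz] xy].
by exists z => //; apply: Order.POrderTheory.le_trans xy yz.
Qed.

Lemma le2_trans (d : Order.disp_t) (Q : porderType d) (X Y Z : set Q) :
  X <=_2 Y -> Y <=_2 Z -> X <=_2 Z.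
Proof.
move=> XY YZ z /YZ [y /XY [x Xx xy] yz].
by exists x => //; apply: Order.POrderTheory.le_trans xy yz.
Qed.

Theorem theorem3p18 (d : Order.disp_t) (A : tbPOrderType d) (T : Type)
    (T_nonempty : inhabited T) (P G : pset (T -> A) -> T -> pset A) :
  (forall C D : pset (T -> A), phi (P C) <=_2 D <-> C <=_1 phi (G D))
  <->
  ((forall C D : pset (T -> A),
      (C <=_1 D -> phi (P C) <=_2 phi (P D)) /\
      (C <=_2 D -> phi (G C) <=_1 phi (G D))) /\
   (forall C : pset (T -> A),
      C <=_1 phi (star G P C) /\ phi (star P G C) <=_2 C)).
Proof.
split=> [PG | [mono unit]].
  (* Reflexivity at [D := phi (P C)], and dually below at [C := phi (G D)]. *)
  have unitG (C : pset (T -> A)) : C <=_1 phi (star G P C)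
    by apply/PG; apply: le2_refl.
  have counitP (C : pset (T -> A)) : phi (star P G C) <=_2 C
    by apply/PG; apply: le1_refl.
  split=> [C D | C]; last by split.
  (* Transposing leaves [C <=_1 phi (star G P D)] and [phi (star P G C) <=_2 D]. *)
  split=> [CD | CD]; apply/PG.
    exact: le1_trans CD (unitG D).
  exact: le2_trans (counitP C) CD.
move=> C D; split=> [PCD | CGD].
  (* Apply [G] to [PCD] and precompose with the unit at [C]; the other direction is dual, with the
     counit at [D]. *)
  exact: le1_trans (proj1 (unit C)) (proj2 (mono _ _) PCD).
exact: le2_trans (proj1 (mono _ _) CGD) (proj2 (unit D)).
Qed.
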